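(* Let $\mathcal{C}\subset\mathbb{R}^p$ be a closed bounded convex set, let $\ell(\cdot;d):\mathcal{C}\to\mathbb{R}$ be convex, $L$-Lipschitz and $\Delta$-strongly convex ($\Delta>0$) for every $d$ in the data universe, and let $\epsilon>0$. Let $\mathcal{D}=\{d_1,\dots,d_n\}$ be a data set, $\mathcal{L}(\theta;\mathcal{D})=\sum_{i=1}^n\ell(\theta;d_i)$ and $\theta^*=\arg\min_{\theta\in\mathcal{C}}\mathcal{L}(\theta;\mathcal{D})$. Suppose that in the output-perturbation-based generic algorithm described in the context, the second-stage algorithm $\mathcal{A}^{\epsilon/2}_{\sf gen-Lip}$ is taken to be the exponential sampling algorithm, or its efficient version (both described in the context). Then the output $\theta^{priv}$ satisfies $$\mathbb{E}\left[\mathcal{L}(\theta^{priv};\mathcal{D})-\mathcal{L}(\theta^*;\mathcal{D})\right]=O\left(\frac{p^2L^2}{n\Delta\epsilon^2}\log(n)\right).$$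
   Context: $O(\cdot)$ hides an absolute multiplicative constant; the expectation is over the randomness of the algorithm. Lipschitz and strong convexity are with respect to the Euclidean norm; $f$ is $\Delta$-strongly convex on $\mathcal{C}$ if $f(y)\ge f(x)+\langle z,y-x\rangle+\frac{\Delta}{2}\|y-x\|_2^2$ for all $x,y\in\mathcal{C}$ and all subgradients $z$ of $f$ at $x$. $\Pi_{\mathcal{C}}$ denotes Euclidean projection onto $\mathcal{C}$; $\|\tilde{\mathcal{C}}\|_2$ denotes the Euclidean diameter of a set $\tilde{\mathcal{C}}$. Output perturbation $\mathcal{A}^{\epsilon'}_{\sf out-pert}$ with privacy parameter $\epsilon'$ and radius parameter $\zeta$: compute $\theta^*=\arg\min_{\theta\in\mathcal{C}}\mathcal{L}(\theta;\mathcal{D})$; set $\theta_0=\Pi_{\mathcal{C}}(\theta^*+b)$, where $b\in\mathbb{R}^p$ is a random vector with density proportional to $e^{-\frac{n\Delta\epsilon'}{2L}\|b\|_2}$; output the set $\mathcal{C}_0=\{\theta\in\mathcal{C}:\|\theta-\theta_0\|_2\le\zeta\frac{2Lp}{\Delta\epsilon' n}\}$. Output-perturbation-based generic algorithm (inputs $\mathcal{D},\ell,\Delta,\epsilon,\mathcal{C}$): 1. Run $\mathcal{A}^{\epsilon/2}_{\sf out-pert}$ (i.e. $\epsilon'=\epsilon/2$) with radius parameter $\zeta=3\log(n)$ to obtain $\mathcal{C}_0$. 2. Run $\mathcal{A}^{\epsilon/2}_{\sf gen-Lip}$, with fresh randomness, on $\mathcal{D}$, $\ell$, privacy parameter $\epsilon/2$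 and convex set $\mathcal{C}_0$, and output the result $\theta^{priv}$. Exponential sampling algorithm, with privacy parameter $\epsilon'$ and convex set $\tilde{\mathcal{C}}$: output a sample from the distribution on $\tilde{\mathcal{C}}$ with Lebesgue density proportional to $\exp\left(-\frac{\epsilon'}{2L\|\tilde{\mathcal{C}}\|_2}\mathcal{L}(\theta;\mathcal{D})\right)$. Efficient version, with privacy parameter $\epsilon'$ and convex set $\tilde{\mathcal{C}}$: a polynomial-time algorithm whose output distribution $\hat\mu$ on $\tilde{\mathcal{C}}$ satisfies $\sup_{\theta}\left|\log\frac{d\hat\mu(\theta)}{d\mu(\theta)}\right|\le\frac{\epsilon'}{3}$, where $\mu$ is the distribution on $\tilde{\mathcal{C}}$ with density proportional to $\exp\left(-\frac{\epsilon'}{6L\|\tilde{\mathcal{C}}\|_2}\mathcal{L}(\theta;\mathcal{D})\right)$.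
   Formalization: With one absolute constant for all ε>0 the bound is false (p=1, n=2, ε→∞). Here, for every c>0, the constant depends only on c, where ε ≤ c(pn)² for exponential sampling and ε ≤ cp for its efficient version; it is thus absolute for ε ≤ 1. *)

(* Defs.v *)
From HB Require Import structures.
From mathcomp Require Import all_boot all_order all_algebra.
From mathcomp Require Import all_classical all_reals all_analysis.
From mathcomp Require Import measurable_realfun.

Set Implicit Arguments.
Unset Strict Implicit.
Unset Printing Implicit Defensive.

Import Order.TTheory GRing.Theory Num.Theory.
Import numFieldNormedType.Exports.

Local Open Scope classical_set_scope.
Local Open Scope ring_scope.

Definition rV_display : measure_display. Proof. exact. Qed.

(* The sigma-algebra on R^p generated by the coordinates (as the library does
   for tuples); it coincides with the Borel sigma-algebra. *)
Section measurable_rV.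
Context {R : realType} {p : nat}.

Let coors : 'I_p -> 'rV[R]_p -> measurableTypeR R := fun i x => x 0 i.

Let rV_set0 : g_sigma_preimage coors set0.
Proof. exact: sigma_algebra0. Qed.

Let rV_setC A : g_sigma_preimage coors A -> g_sigma_preimage coors (~` A).
Proof. exact: sigma_algebraC. Qed.

Let rV_bigcup (F : _^nat) : (forall i, g_sigma_preimage coors (F i)) ->
  g_sigma_preimage coors (\bigcup_i (F i)).
Proof. exact: sigma_algebra_bigcup. Qed.

HB.instance Definition _ := @isMeasurable.Build rV_display
  'rV[R]_p (g_sigma_preimage coors) rV_set0 rV_setC rV_bigcup.

End measurable_rV.

Section measurable_coordinates.
Context {R : realType}.

Lemma measurable_coord p (i : 'I_p) :
  measurable_fun [set: 'rV[R]_p] (fun x => x 0 i : measurableTypeR R).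
Proof.
move=> _ Y mY; rewrite setTI; apply: sub_sigma_algebra => /=.
rewrite -bigcup_seq/=; exists i => /=; first by rewrite mem_index_enum.
by exists Y => //; rewrite setTI.
Qed.

Lemma measurable_fun_coordP d (T : measurableType d) p (f : T -> 'rV[R]_p) :
  (forall i, measurable_fun [set: T] (fun x => f x 0 i : measurableTypeR R)) ->
  measurable_fun [set: T] f.
Proof.
move=> mf _ A mA; rewrite setTI.
suff : measurable `<=` [set A : set 'rV[R]_p | measurable (f @^-1` A)].
  exact.
apply: smallest_sub.
  split => /=.
  - by rewrite preimage_set0.
  - by move=> B mB; rewrite setTD preimage_setC; exact: measurableC.
  - by move=> F mF; rewrite preimage_bigcup; exact: bigcupT_measurable.
rewrite -bigcup_seq => B /= [i _ [Y mY <-]] /=.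
by rewrite setTI; have := mf i measurableT Y mY; rewrite setTI.
Qed.

End measurable_coordinates.

(* Lebesgue measure on R^p, by recursion on p through R^(p+1) = R x R^p. *)
Section lebesgue_rV.
Context {R : realType}.

Definition cons_rV p (x : measurableTypeR R * 'rV[R]_p) : 'rV[R]_p.+1 :=
  \row_i (if unlift ord0 i is Some j then x.2 0 j else x.1).

Definition uncons_rV p (v : 'rV[R]_p.+1) : measurableTypeR R * 'rV[R]_p :=
  (v 0 ord0, \row_j v 0 (lift ord0 j)).

Lemma cons_rVK p : cancel (@cons_rV p) (@uncons_rV p).
Proof.
case=> a v; rewrite /uncons_rV; congr pair.
  by rewrite mxE unlift_none.
by apply/rowP => j; rewrite !mxE liftK.
Qed.

Lemma uncons_rVK p : cancel (@uncons_rV p) (@cons_rV p).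
Proof.
by move=> v; apply/rowP => i; rewrite mxE; case: unliftP => [j|] ->;
  rewrite /= ?mxE.
Qed.

Lemma measurable_cons_rV p : measurable_fun setT (@cons_rV p).
Proof.
apply: measurable_fun_coordP => i.
case: (unliftP ord0 i) => [j|] ->.
  rewrite (_ : (fun _ => _) = (fun v : 'rV[R]_p => v 0 j) \o snd); last first.
    by apply/funext => x; rewrite mxE liftK.
  exact: (measurableT_comp (measurable_coord j) measurable_snd).
rewrite (_ : (fun _ => _) = fst); first exact: measurable_fst.
by apply/funext => x; rewrite mxE unlift_none.
Qed.

Lemma measurable_uncons_rV p : measurable_fun setT (@uncons_rV p).
Proof.
apply/measurable_fun_pairP; split; first exact: measurable_coord.
apply: measurable_fun_coordP => i.
rewrite (_ : (fun _ => _) = (fun x : 'rV[R]_p.+1 => x 0 (lift ord0 i))).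
  exact: measurable_coord.
by apply/funext => x; rewrite /= mxE.
Qed.

Section cons_measure.
Context {p : nat} (m : {sigma_finite_measure set 'rV[R]_p -> \bar R}).

Definition cons_measure : set 'rV[R]_p.+1 -> \bar R :=
  pushforward (lebesgue_measure \x m)%E (@cons_rV p).

Let cons_measure0 : cons_measure set0 = 0%E.
Proof. by rewrite /cons_measure /pushforward preimage_set0 measure0. Qed.

Let cons_measure_ge0 A : (0 <= cons_measure A)%E.
Proof. by rewrite /cons_measure /pushforward measure_ge0. Qed.

Let cons_measure_sigma_additive : semi_sigma_additive cons_measure.
Proof.
have mpre A : measurable A -> measurable (@cons_rV p @^-1` A).
  by move=> mA; rewrite -[X in measurable X]setTI; exact: measurable_cons_rV.
move=> F mF tF mUF; rewrite /cons_measure /pushforward preimage_bigcup.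
apply: measure_semi_sigma_additive; first by move=> n; exact: mpre.
- apply/trivIsetP => /= i j _ _ ij; rewrite -preimage_setI.
  by move/trivIsetP : tF => /(_ _ _ _ _ ij) ->//; rewrite preimage_set0.
- by rewrite -preimage_bigcup; exact: mpre.
Qed.

HB.instance Definition _ := isMeasure.Build _ _ _ cons_measure
  cons_measure0 cons_measure_ge0 cons_measure_sigma_additive.

Let cons_measure_sigma_finite : sigma_finite setT cons_measure.
Proof.
have /sigma_finiteP[F [FT ndF Foo]] :=
  sigma_finiteT (@lebesgue_measure R).
have /sigma_finiteP[G [GT ndG Goo]] := sigma_finiteT m.
exists (fun k => @uncons_rV p @^-1` (F k `*` G k)).
  rewrite -preimage_bigcup -[LHS](preimage_setT (@uncons_rV p)).
  congr (_ @^-1` _); rewrite -setXTT FT GT predeqE => -[x y]; split.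
    move=> [/= [k _ Fkx] [l _ Gly]]; exists (maxn k l) => //; split.
    - by move: x Fkx; exact/subsetPset/ndF/leq_maxl.
    - by move: y Gly; exact/subsetPset/ndG/leq_maxr.
  by move=> [k _ []/= ? ?]; split; exists k.
move=> k; have [mF Fk] := Foo k; have [mG Gk] := Goo k; split.
  rewrite -[X in measurable X]setTI; apply: measurable_uncons_rV => //.
  exact: measurableX.
rewrite /cons_measure /pushforward -comp_preimage.
rewrite (_ : _ \o _ = id) ?preimage_id.
  by rewrite product_measure1E// lte_mul_pinfty// ge0_fin_numE.
by apply/funext => x; exact: cons_rVK.
Qed.

HB.instance Definition _ := @Measure_isSigmaFinite.Build _ _ _ cons_measure
  cons_measure_sigma_finite.

End cons_measure.

Fixpoint lebesgue_rV p : {sigma_finite_measure set 'rV[R]_p -> \bar R} :=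
  if p is q.+1 then cons_measure (lebesgue_rV q) else \d_(0 : 'rV[R]_0).

Lemma lebesgue_rV_box p (a b : 'I_p -> R) : (forall i, a i <= b i) ->
  lebesgue_rV p [set x | forall i, a i <= x 0 i <= b i] =
  (\prod_(i < p) (b i - a i))%:E.
Proof.
elim: p a b => [|p IHp] a b ab.
  rewrite big_ord0 /= diracE mem_set//; by case.
rewrite big_ord_recl EFinM -IHp; last by move=> i; exact: ab.
rewrite /= /cons_measure /pushforward.
rewrite (_ : _ @^-1` _ = `[a ord0, b ord0]%classic `*`
    [set x : 'rV[R]_p | forall i, a (lift ord0 i) <= x 0 i <= b (lift ord0 i)]).
  rewrite product_measure1E//=.
    rewrite lebesgue_measure_itv/= lte_fin; case: ltP => // ba.
    have -> : b ord0 = a ord0 by apply/eqP; rewrite eq_le ba ab.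
    by rewrite subrr mul0e.
  rewrite (_ : [set _ | _] = \bigcap_(i in [set: 'I_p])
      ((fun x : 'rV[R]_p => x 0 i) @^-1`
        `[a (lift ord0 i), b (lift ord0 i)]%classic)).
    apply: fin_bigcap_measurable => // i _; rewrite -[X in measurable X]setTI.
    by apply: (@measurable_coord R p i) => //; exact: measurable_itv.
  apply/seteqP; split => x /= xab i; first by move=> _ /=; rewrite in_itv/= xab.
  by have := xab i Logic.I; rewrite /= in_itv.
apply/seteqP; split => [[x v]|[x v]] /=.
  move=> xab; split; first by have := xab ord0; rewrite mxE unlift_none in_itv.
  by move=> i; have := xab (lift ord0 i); rewrite mxE liftK.
rewrite in_itv/= => -[xab vab] i.
by case: (unliftP ord0 i) => [j|] ->; rewrite mxE ?liftK ?unlift_none.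
Qed.

End lebesgue_rV.

Section euclidean_convexity.
Context {R : realType} {p : nat}.
Implicit Types (x y z : 'rV[R]_p) (C : set 'rV[R]_p) (f : 'rV[R]_p -> R).

Definition dot x y : R := \sum_i x 0 i * y 0 i.

(* The library's norm `|x| on 'rV_p is the sup norm. *)
Definition enorm x : R := Num.sqrt (dot x x).

Definition ediam C : R := sup [set enorm (x - y) | x in C & y in C].

Definition elipschitz C (L : R) f :=
  forall x y, C x -> C y -> `|f x - f y| <= L * enorm (x - y).

Definition subgradient C f x z :=
  forall y, C y -> f x + dot z (y - x) <= f y.

Definition strongly_convex C (Delta : R) f :=
  forall x y z, C x -> C y -> subgradient C f x z ->
    f x + dot z (y - x) + Delta / 2 * enorm (y - x) ^+ 2 <= f y.

Definition is_argmin C f x := C x /\ forall y, C y -> f x <= f y.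

Definition eproj C x : 'rV[R]_p :=
  xget 0 (is_argmin C (fun y => enorm (x - y))).

End euclidean_convexity.

Section algorithms.
Context {R : realType} {p : nat}.
Implicit Types (C S : set 'rV[R]_p) (f : 'rV[R]_p -> R).

(* mu is the distribution on S whose Lebesgue density is proportional to w. *)
Definition has_density_propto S (w : 'rV[R]_p -> R)
    (mu : probability 'rV[R]_p R) :=
  exists2 c : R, 0 < c & forall B, measurable B ->
    mu B = (\int[lebesgue_rV p]_(x in B `&` S) (c * w x)%:E)%E.

Definition empirical_risk (U : Type) (ell : U -> 'rV[R]_p -> R) (n : nat)
    (D : n.-tuple U) (theta : 'rV[R]_p) : R :=
  \sum_(i < n) ell (tnth D i) theta.

Definition out_pert_noise (n : nat) (L Delta eps : R) :=
  has_density_propto setT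
    (fun b => expR (- (n%:R * Delta * eps / (2 * L)) * enorm b)).

Definition out_pert_set C (n : nat) (L Delta eps zeta : R)
    (thstar b : 'rV[R]_p) : set 'rV[R]_p :=
  let th0 := eproj C (thstar + b) in
  [set theta | C theta /\
    enorm (theta - th0) <= zeta * (2 * L * p%:R / (Delta * eps * n%:R))].

Definition exp_sampling (L eps : R) f S :=
  has_density_propto S (fun theta => expR (- (eps / (2 * L * ediam S)) * f theta)).

(* The density of nu with respect to mu is g; running time is not modelled. *)
Definition efficient_exp_sampling (L eps : R) f S
    (nu : probability 'rV[R]_p R) :=
  exists (mu : probability 'rV[R]_p R) (g : 'rV[R]_p -> R),
    [/\ has_density_propto S
          (fun theta => expR (- (eps / (6 * L * ediam S)) * f theta)) mu,
        measurable_fun S (g : 'rV[R]_p -> measurableTypeR R),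
        forall theta, S theta -> 0 < g theta /\ `|ln (g theta)| <= eps / 3 &
        forall B, measurable B ->
          nu B = (\int[mu]_(theta in B `&` S) (g theta)%:E)%E].

(* The expectation of h(theta^priv) when b is drawn from noise and then
   theta^priv from A (C0 b), independently of b given C0 b. *)
Definition two_stage_expectation (noise : probability 'rV[R]_p R)
    (C0 : 'rV[R]_p -> set 'rV[R]_p)
    (A : set 'rV[R]_p -> probability 'rV[R]_p R) C (h : 'rV[R]_p -> R) : \bar R :=
  (\int[noise]_b \int[A (C0 b)]_(theta in C) (h theta)%:E)%E.

End algorithms.

(* The O(.) bound on the excess risk cannot hold with one constant for all
   eps > 0.  With p = 1 and ell t = L' |t| + Delta t^2 / 2, the event that
   theta^* is outside C_0 contributes order L^2 / (Delta eps n^3), which exceeds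
   p^2 L^2 log n / (n Delta eps^2) when eps >> n^2 log n; and the closeness
   allowed by efficient_exp_sampling permits an excess of order
   L^2 log n / (Delta eps n), which exceeds it when eps >> p.  Hence the constant
   is taken to be absolute on eps <= c (p n)^2, respectively eps <= c p, for
   each c > 0; both ranges contain eps <= c. *)

(* Main.v *)
(* Write f for the empirical risk, r for the radius of C_0 and b for the noise.
   If mu has density proportional to exp (- phi) on a convex set S, with phi
   convex, the change of variables x |-> t x + (1 - t) x0 gives, for every x0
   in S,
     E_mu exp ((1 - t) (phi - phi x0)) <= t ^ (- p).
   For phi = beta f and t = 1/2, Jensen's inequality bounds the mean of f - f x0
   over the second stage by O(p / beta), also after a change of density by a
   factor exp (O(p)); here p / beta = O(p L r / eps).  For phi proportional to
   the Euclidean norm and x0 = 0 the same inequality is a Chernoff bound for the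
   noise.  As projections are nonexpansive, C_0 comes within (|b| - r)_+ of the
   minimizer, and the Chernoff bound with r = 3 log n E|b| makes the expectation
   of (|b| - r)_+ of order n^(-3) log n in units of E|b| / p. *)
Require Import Defs.
From HB Require Import structures.
From mathcomp Require Import all_boot all_order all_algebra.
From mathcomp Require Import all_classical all_reals all_analysis.
From mathcomp Require Import measurable_realfun lra ring.

Set Implicit Arguments.
Unset Strict Implicit.
Unset Printing Implicit Defensive.

Import Order.TTheory GRing.Theory Num.Theory.
Import numFieldNormedType.Exports.

Local Open Scope classical_set_scope.
Local Open Scope ring_scope.

(** * Integration against a measure given by a density *)

Section density.
Local Open Scope ereal_scope.
Context d (T : measurableType d) (R : realType).

Import HBNNSimple.

(** The hypothesis on [nu] settles indicators of level sets, linearity settles simple functions, and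
    monotone convergence along [nnsfun_approx] passes to [F] on both sides. *)
Lemma ge0_integral_density (mu nu : {measure set T -> \bar R}) (w : T -> R)
    (F : T -> \bar R) :
  (forall x, (0 <= w x)%R) -> measurable_fun setT w ->
  (forall B, measurable B -> nu B = \int[mu]_(x in B) (w x)%:E) ->
  (forall x, 0 <= F x) -> measurable_fun setT F ->
  \int[nu]_x F x = \int[mu]_x (F x * (w x)%:E).
Proof.
move=> w0 mw nuE F0 mF.
have mwE : measurable_fun setT (EFin \o w) by exact/measurable_EFinP.
pose h := nnsfun_approx measurableT mF.
have hF x : EFin (h n x) @[n --> \oo] --> F x by exact: cvg_nnsfun_approx.
have hnd x : {homo (fun n => h n x) : a b / (a <= b)%N >-> (a <= b)%R}.
  by move=> a b ab; exact/lefP/nd_nnsfun_approx.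
have mh n : measurable_fun setT (EFin \o h n) by exact/measurable_EFinP.
transitivity (limn (fun n => \int[nu]_x (h n x)%:E)).
  rewrite -monotone_convergence//.
  - by apply: eq_integral => x _; apply/esym/cvg_lim => //; exact: hF.
  - by move=> n x _; rewrite lee_fin.
  - by move=> x _ a b ab; rewrite lee_fin hnd.
transitivity (limn (fun n => \int[mu]_x ((h n x)%:E * (w x)%:E))); last first.
  rewrite -monotone_convergence//.
  - apply: eq_integral => x _; apply/cvg_lim => //.
    by apply: cvgeZr => //; exact: hF.
  - by move=> n; exact: (emeasurable_funM (mh n) mwE).
  - by move=> n x _; rewrite mule_ge0// lee_fin.
  - by move=> x _ a b ab; rewrite lee_wpmul2r ?lee_fin ?hnd.
congr (limn _); apply/funext => n.
have indich r : measurable_fun setT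
    (fun x => (r * \1_(h n @^-1` [set r]) x)%:E).
  by apply/measurable_EFinP; exact: measurable_funM.
have nni r x : 0 <= (r * \1_(h n @^-1` [set r]) x)%:E.
  exact: nnfun_muleindic_ge0.
transitivity (\int[nu]_x
    (\sum_(y \in range (h n)) (y * \1_(h n @^-1` [set y]) x)%:E)).
  by apply: eq_integral => x _; rewrite [in LHS]fimfunE fsumEFin.
transitivity (\int[mu]_x (\sum_(y \in range (h n))
    (y * \1_(h n @^-1` [set y]) x)%:E * (w x)%:E)); last first.
  apply: eq_integral => x _.
  by rewrite -ge0_mule_fsuml// fsumEFin// -fimfunE.
have mindw r : measurable_fun setT
    (fun x => (r * \1_(h n @^-1` [set r]) x)%:E * (w x)%:E).
  exact: (emeasurable_funM (indich r) mwE).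
rewrite !ge0_integral_fsum//; last by move=> r x _; rewrite mule_ge0// lee_fin.
apply: eq_fsbigr => r /[!inE] -[x _ <-{r}].
have mA : measurable (h n @^-1` [set h n x]) by [].
rewrite integralZl_indic_nnsfun//= integral_indic// setIT nuE//.
rewrite (integral_mkcond (h n @^-1` _)) -ge0_integralZl//.
- apply: eq_integral => y _.
  by rewrite EFinM -muleA epatch_indic [_ * (w y)%:E]muleC.
- exact/(measurable_restrictT _ _).1/measurable_funTS.
- by move=> y _; apply: erestrict_ge0 => ? _; rewrite lee_fin.
- by rewrite lee_fin.
Qed.

End density.

(** * Affine change of variables for Lebesgue measure *)

Section lebesgue_affine.
Local Open Scope ereal_scope.
Context (R : realType).

Local Notation mu := (@lebesgue_measure R).

(** The pushforward of [mu] under the affine map, scaled by [t], agrees with [mu] on half-open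
    intervals, so uniqueness of Lebesgue measure identifies the two. *)
Lemma ge0_integral_lebesgue_affine (t v : R) (F : measurableTypeR R -> \bar R) :
  (0 < t)%R -> (forall x, 0 <= F x) -> measurable_fun setT F ->
  \int[mu]_x F x = t%:E * \int[mu]_x F (t * x + v)%R.
Proof.
move=> t0 F0 mF.
pose f (x : measurableTypeR R) : measurableTypeR R := (t * x + v)%R.
have mf : measurable_fun setT f.
  by apply: measurable_funD => //; exact: measurable_funM.
pose m' : {measure set measurableTypeR R -> \bar R} :=
  mscale (NngNum (ltW t0)) (pushforward mu f).
pose m := m' mf.
have muE A : measurable A -> mu A = m A.
  apply: lebesgue_measure_unique => // _ [[a b] _ <-].
  transitivity (t%:E * mu `](a - v) / t, (b - v) / t]%classic%R).
    rewrite !lebesgue_measure_itv/= !lte_fin ltr_pM2r ?invr_gt0// ltrD2r.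
    case: ifP => _; rewrite ?mule0//.
    by rewrite -!EFinD -EFinM; congr EFin; field; exact: lt0r_neq0.
  congr (_ * mu _); apply/seteqP; split => x /=;
    by rewrite /f !in_itv/= ltr_pdivrMr// ler_pdivlMr//; lra.
rewrite (eq_measure_integral m); last by move=> A mA _; exact: muE.
rewrite ge0_integral_mscale//; congr (_ * _).
by rewrite (ge0_integral_pushforward mf).
Qed.

End lebesgue_affine.

Section lebesgue_rV_affine.
Local Open Scope ereal_scope.
Context (R : realType).
Local Notation mu := (@lebesgue_measure R).

Lemma ge0_integral_lebesgue_rVS p (F : 'rV[R]_p.+1 -> \bar R) :
  (forall x, 0 <= F x) -> measurable_fun setT F ->
  \int[lebesgue_rV p.+1]_x F x =
  \int[mu]_x \int[lebesgue_rV p]_y F (cons_rV (x, y)).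
Proof.
move=> F0 mF.
transitivity (\int[mu \x lebesgue_rV p]_z (F \o @cons_rV R p) z).
  rewrite -(preimage_setT (@cons_rV R p)).
  by rewrite -(ge0_integral_pushforward (@measurable_cons_rV R p)).
rewrite fubini_tonelli1// => [|x]; last exact: F0.
by apply: measurableT_comp => //; exact: measurable_cons_rV.
Qed.

Lemma measurable_integral_cons_rV p (F : 'rV[R]_p.+1 -> \bar R) :
  (forall x, 0 <= F x) -> measurable_fun setT F ->
  measurable_fun setT (fun x : measurableTypeR R =>
    \int[lebesgue_rV p]_y F (cons_rV (x, y))).
Proof.
move=> F0 mF; have mFc := measurableT_comp mF (@measurable_cons_rV R p).
by apply: (measurable_fun_fubini_tonelli_F (m2 := lebesgue_rV p) _ mFc) => z;
  exact: F0.
Qed.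

Lemma measurable_affine_rV p (t : R) (v : 'rV[R]_p) :
  measurable_fun setT (fun x : 'rV[R]_p => t *: x + v)%R.
Proof.
apply: measurable_fun_coordP => i.
rewrite (_ : (fun _ => _) = (fun x : 'rV[R]_p => t * x 0 i + v 0 i)%R);
  last first.
  by apply/funext => x; rewrite !mxE.
apply: measurable_funD => //; apply: measurable_funM => //.
exact: measurable_coord.
Qed.

(** Induction on the dimension: Tonelli splits off the first coordinate, which contributes one
    factor [t]. In dimension 0 both sides evaluate [F] at the only point. *)
Lemma ge0_integral_lebesgue_rV_affine p (t : R) (v : 'rV[R]_p)
    (F : 'rV[R]_p -> \bar R) :
  (0 < t)%R -> (forall x, 0 <= F x) -> measurable_fun setT F ->
  \int[lebesgue_rV p]_x F x =
  (t ^+ p)%:E * \int[lebesgue_rV p]_x F (t *: x + v)%R.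
Proof.
move=> t0; elim: p v F => [|p IHp] v F F0 mF.
  rewrite !integral_dirac//; last first.
    exact: (measurableT_comp mF (measurable_affine_rV t v)).
  rewrite !diracT !mul1e; congr F.
  by apply/rowP; case.
have mFa : measurable_fun setT (fun x : 'rV[R]_p.+1 => F (t *: x + v)%R).
  exact: (measurableT_comp mF (measurable_affine_rV t v)).
rewrite !ge0_integral_lebesgue_rVS//.
pose v' : 'rV[R]_p := (\row_j v 0 (lift ord0 j))%R.
pose G (x : measurableTypeR R) := \int[lebesgue_rV p]_y F (cons_rV (x, y)).
have mFc := measurableT_comp mF (@measurable_cons_rV R p).
have mG : measurable_fun setT G by exact: measurable_integral_cons_rV.
have G0 x : 0 <= G x by apply: integral_ge0.
(* The induction hypothesis is applied to the slice of [F] whose first coordinate is already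
   transformed; only the remaining coordinates [v'] of the translation are left to it. *)
have inner x : t%:E ^+ p * \int[lebesgue_rV p]_y F (t *: cons_rV (x, y) + v)%R
    = G (t * x + v 0 ord0)%R.
  have /IHp IH : measurable_fun setT
      (fun y => F (cons_rV ((t * x + v 0 ord0)%R, y))).
    exact: (measurable_fun_pair2 (t * x + v 0 ord0)%R mFc).
  rewrite /G (IH v')// EFin_expe; congr (_ * _).
  apply: eq_integral => y _; congr F.
  apply/rowP => i; rewrite !mxE; case: unliftP => [j|] -> //=.
  by rewrite !mxE.
rewrite (ge0_integral_lebesgue_affine (v 0%R ord0) t0 G0 mG).
under eq_integral do rewrite -inner.
rewrite EFin_expe ge0_integralZl//.
- by rewrite muleA -expeS.
- exact: (measurable_integral_cons_rV _ mFa).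
- by move=> x _; exact: integral_ge0.
- by rewrite expe_ge0// lee_fin ltW.
Qed.
End lebesgue_rV_affine.

(** * Exponential moments of densities proportional to [expR (- phi)] *)

Section density_moment.
Context (R : realType) (p : nat).
Implicit Types (S : set 'rV[R]_p) (mu : probability 'rV[R]_p R).

(** Absorbing the constant and extending by zero off [S] gives a density on the whole space, the
    form that [ge0_integral_density] expects. *)
Lemma has_density_proptoE S (w : 'rV[R]_p -> R) mu :
  measurable S -> measurable_fun S (w : _ -> measurableTypeR R) ->
  (forall x, S x -> 0 <= w x) -> has_density_propto S w mu ->
  exists2 W : 'rV[R]_p -> R,
    [/\ forall x, 0 <= W x, measurable_fun setT (W : _ -> measurableTypeR R) &
      exists2 c, 0 < c & forall x, S x -> W x = c * w x] &
    forall B, measurable B -> mu B = (\int[lebesgue_rV p]_(x in B) (W x)%:E)%E.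
Proof.
move=> mS mw w0 [c c0 muE].
pose W := (fun x => c * w x) \_ S.
exists W.
  split.
  - move=> x; rewrite /W patchE; case: ifPn => // /[!inE] Sx.
    by rewrite mulr_ge0 ?w0// ltW.
  - apply: (proj1 (measurable_restrictT
      (fun x => c * w x : measurableTypeR R) mS)).
    exact: measurable_funM.
  - by exists c => // x Sx; rewrite /W patchE mem_set.
move=> B mB; rewrite muE// integral_mkcondr; apply: eq_integral => x _.
by rewrite /W !patchE; case: ifP.
Qed.

(* The contraction [x |-> t x + (1 - t) x0] maps S into S and multiplies
   Lebesgue measure by [t ^+ p], while convexity of phi bounds the density from
   below along it. *)
Lemma expR_moment_propto S (phi : 'rV[R]_p -> R) mu (x0 : 'rV[R]_p) (t : R) :
  measurable S -> measurable_fun S (phi : _ -> measurableTypeR R) ->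
  0 < t ->
  (forall x, S x -> S (t *: x + (1 - t) *: x0)) ->
  (forall x, S x ->
    phi (t *: x + (1 - t) *: x0) <= t * phi x + (1 - t) * phi x0) ->
  has_density_propto S (fun x => expR (- phi x)) mu ->
  (\int[mu]_(x in S) (expR ((1 - t) * (phi x - phi x0)))%:E <= (t ^- p)%:E)%E.
Proof.
move=> mS mphi t0 St phit muS.
have mexp : measurable_fun S (fun x => expR (- phi x) : measurableTypeR R).
  by apply: measurableT_comp => //; exact: measurableT_comp.
have [|W [W0 mW [c c0 WE]] muE] := has_density_proptoE mS mexp _ muS.
  by move=> x _; exact: expR_ge0.
have mWE : measurable_fun setT (EFin \o W) by exact/measurable_EFinP.
pose f (x : 'rV[R]_p) := expR ((1 - t) * (phi x - phi x0)).
have mf : measurable_fun S (f : _ -> measurableTypeR R).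
  apply: measurableT_comp => //; apply: measurable_funM => //.
  exact: measurable_funB.
rewrite integral_mkcond.
have mF : measurable_fun setT ((EFin \o f) \_ S).
  by apply: (proj1 (measurable_restrictT _ mS)); exact/measurable_EFinP.
have F0 x : (0 <= ((EFin \o f) \_ S) x)%E.
  by apply: erestrict_ge0 => y _ /=; rewrite lee_fin expR_ge0.
rewrite (ge0_integral_density W0 mW muE F0 mF).
have mWa := measurableT_comp mWE (measurable_affine_rV t ((1 - t) *: x0)).
(* On [S] the integrand is [c * expR (- (t * phi x + (1 - t) * phi x0))], at most the density at the
   contracted point; off [S] it vanishes. *)
apply: (@le_trans _ _
  (\int[lebesgue_rV p]_x (W (t *: x + (1 - t) *: x0))%:E)%E).
  apply: ge0_le_integral => //.
  - by move=> x _; rewrite mule_ge0// lee_fin.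
  - exact: emeasurable_funM.
  - move=> x _; rewrite patchE; case: ifPn => [/[!inE] Sx|_]; last first.
      by rewrite mul0e lee_fin.
    rewrite -EFinM lee_fin !WE//; last exact: St.
    rewrite /f mulrCA -expRD ler_pM2l// ler_expR.
    have := phit x Sx; lra.
have tp0 : 0 < t ^+ p by rewrite exprn_gt0.
(* The change of variables in the total mass of [mu] gives the bounding integral the exact value
   [t ^- p]. *)
have : (\int[lebesgue_rV p]_x (W x)%:E = 1)%E.
  by rewrite -muE// probability_setT.
rewrite (ge0_integral_lebesgue_rV_affine ((1 - t) *: x0) t0)//.
move=> /(congr1 (fun x => (t ^- p)%:E * x)%E).
by rewrite muleA -EFinM mulVf ?gt_eqF// mul1e mule1 => ->.
Qed.

End density_moment.

(** * Euclidean inner product and norm *)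

Section euclidean_norm.
Context (R : realType) (p : nat).
Implicit Types (x y z : 'rV[R]_p) (a : R).

Lemma dotC x y : dot x y = dot y x.
Proof. by apply: eq_bigr => i _; rewrite mulrC. Qed.

Lemma dotDl x y z : dot (x + y) z = dot x z + dot y z.
Proof. by rewrite -big_split; apply: eq_bigr => i _; rewrite mxE mulrDl. Qed.

Lemma dotZl a x y : dot (a *: x) y = a * dot x y.
Proof. by rewrite mulr_sumr; apply: eq_bigr => i _; rewrite mxE mulrA. Qed.

Lemma dotDr x y z : dot z (x + y) = dot z x + dot z y.
Proof. by rewrite ![dot z _]dotC dotDl. Qed.

Lemma dotZr a x y : dot x (a *: y) = a * dot x y.
Proof. by rewrite ![dot x _]dotC dotZl. Qed.

Lemma dotNl x y : dot (- x) y = - dot x y.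
Proof. by rewrite -scaleN1r dotZl mulN1r. Qed.

Lemma dotNr x y : dot x (- y) = - dot x y.
Proof. by rewrite ![dot x _]dotC dotNl. Qed.

Lemma dot_ge0 x : 0 <= dot x x.
Proof. by apply: sumr_ge0 => i _; rewrite -expr2 sqr_ge0. Qed.

Lemma dot_eq0 x : dot x x = 0 -> x = 0.
Proof.
move=> /psumr_eq0P x0; apply/rowP => i; rewrite mxE; apply/eqP.
by rewrite -[_ == 0]orbb -mulf_eq0 x0// => j _; rewrite -expr2 sqr_ge0.
Qed.

Lemma enorm_ge0 x : 0 <= enorm x.
Proof. exact: sqrtr_ge0. Qed.

Lemma enorm_sqr x : enorm x ^+ 2 = dot x x.
Proof. by rewrite sqr_sqrtr// dot_ge0. Qed.

Lemma enorm0_eq0 x : enorm x = 0 -> x = 0.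
Proof. by move=> x0; apply: dot_eq0; rewrite -enorm_sqr x0 expr0n. Qed.

Lemma enorm0 : enorm (0 : 'rV[R]_p) = 0.
Proof.
by rewrite /enorm [dot _ _]big1 ?sqrtr0// => i _; rewrite mxE mul0r.
Qed.

Lemma enormZ a x : enorm (a *: x) = `|a| * enorm x.
Proof.
by rewrite /enorm dotZl dotZr mulrA -expr2 sqrtrM ?sqr_ge0// sqrtr_sqr.
Qed.

Lemma enormN x : enorm (- x) = enorm x.
Proof. by rewrite -scaleN1r enormZ normrN1 mul1r. Qed.

Lemma enormC x y : enorm (x - y) = enorm (y - x).
Proof. by rewrite -enormN opprB. Qed.

(** Cauchy-Schwarz, obtained by expanding the squared norm of [enorm y ^+ 2 *: x - dot x y *: y]. *)
Lemma dot_le_enorm x y : dot x y <= enorm x * enorm y.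
Proof.
have [y0|y0] := eqVneq (enorm y) 0.
  rewrite (enorm0_eq0 y0) -(scale0r (0 : 'rV[R]_p)) dotZr mul0r.
  by rewrite mulr_ge0 ?enorm_ge0.
have ygt0 : 0 < enorm y by rewrite lt_neqAle eq_sym y0 enorm_ge0.
have [xy0|xy0] := leP (dot x y) 0.
  by rewrite (le_trans xy0)// mulr_ge0 ?enorm_ge0.
rewrite -(ler_pXn2r (n := 2))// ?nnegrE ?mulr_ge0 ?enorm_ge0// ?(ltW xy0)//.
have := dot_ge0 (enorm y ^+ 2 *: x - dot x y *: y).
rewrite !(dotDl, dotDr, dotNl, dotNr, dotZl, dotZr) (dotC y x) -!enorm_sqr.
set a := enorm x; set b := enorm y; set c := dot x y => h.
have : 0 <= b ^+ 2 * (a ^+ 2 * b ^+ 2 - c ^+ 2) by apply: (le_trans h); lra.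
by rewrite pmulr_rge0 ?exprn_gt0// subr_ge0 exprMn.
Qed.

Lemma ler_enormD x y : enorm (x + y) <= enorm x + enorm y.
Proof.
rewrite -(ler_pXn2r (n := 2))// ?nnegrE ?addr_ge0 ?enorm_ge0//.
rewrite sqrrD !enorm_sqr !(dotDl, dotDr) (dotC y x).
by have := dot_le_enorm x y; lra.
Qed.

Lemma ler_enorm_dist x y z : enorm (x - z) <= enorm (x - y) + enorm (y - z).
Proof. by have := ler_enormD (x - y) (y - z); rewrite addrA subrK. Qed.

Lemma ler_dist_enorm x y : `|enorm x - enorm y| <= enorm (x - y).
Proof.
have := ler_enormD (x - y) y; have := ler_enormD (y - x) x.
by rewrite !subrK [enorm (y - x)]enormC ler_norml; lra.
Qed.

Lemma enorm_conv a x y : 0 <= a <= 1 ->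
  enorm (a *: x + (1 - a) *: y) <= a * enorm x + (1 - a) * enorm y.
Proof.
move=> /andP[a0 a1]; apply: (le_trans (ler_enormD _ _)).
by rewrite !enormZ !ger0_norm// subr_ge0.
Qed.

Lemma ler_coord_enorm x i : `|x 0 i| <= enorm x.
Proof.
rewrite -(ler_pXn2r (n := 2))// ?nnegrE ?normr_ge0 ?enorm_ge0//.
rewrite enorm_sqr real_normK ?num_real// /dot (bigD1 i)//= -expr2 lerDl.
by apply: sumr_ge0 => j _; rewrite -expr2 sqr_ge0.
Qed.

Lemma ler_norm_enorm x : `|x| <= enorm x.
Proof.
rewrite /Num.Def.normr/= mx_normrE; apply/bigmax_leP; split=> [|[i j] _ /=].
  exact: enorm_ge0.
by rewrite (ord1 i) ler_coord_enorm.
Qed.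

(** The topology comes from the sup norm. The crude factor [p], in place of its square root, is
    enough to deduce continuity from a Euclidean Lipschitz bound. *)
Lemma enorm_ler_norm x : enorm x <= p%:R * `|x|.
Proof.
have xi i : `|x 0 i| <= `|x|.
  rewrite [leRHS]/Num.Def.normr/= mx_normrE.
  exact: (le_bigmax _ (fun k : 'I_1 * 'I_p => `|x k.1 k.2|) (0, i)).
rewrite -(ler_pXn2r (n := 2))// ?nnegrE ?mulr_ge0 ?enorm_ge0//.
rewrite enorm_sqr exprMn; apply: (@le_trans _ _ (p%:R * `|x| ^+ 2)).
  have -> : p%:R * `|x| ^+ 2 = \sum_(i < p) `|x| ^+ 2.
    by rewrite sumr_const card_ord mulr_natl.
  apply: ler_sum => i _.
  by rewrite -expr2 -real_normK ?num_real// ler_pXn2r// nnegrE.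
rewrite ler_wpM2r ?sqr_ge0//; case: (p) => [|n]; first by rewrite expr0n.
by rewrite expr2 ler_peMl// ler1n.
Qed.

End euclidean_norm.

(** * Topology and measurability on row vectors *)

Section topology_rV.
Context (R : realType) (p : nat).
Implicit Types (x y z : 'rV[R]_p) (C U S : set 'rV[R]_p).

Lemma measurable_ball_rV x (e : R) : 0 < e -> measurable (ball x e).
Proof.
move=> e0.
rewrite (_ : ball x e = \bigcap_(i in [set: 'I_p])
    ((fun y : 'rV[R]_p => y 0 i) @^-1` ball (x 0 i) e)).
  apply: fin_bigcap_measurable => // i _; rewrite -[X in measurable X]setTI.
  by apply: (@measurable_coord R p i) => //; exact: measurable_ball.
apply/seteqP; split => y.
  by move=> [_ xy] i _; exact: xy.
by move=> xy; split => // i j; rewrite (ord1 i); exact: xy.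
Qed.

(** An open set is the union of the countably many sup-norm balls with rational center and radius
    [k.+1%:R^-1] that it contains, and such balls are boxes. *)
Lemma open_measurable_rV U : open U -> measurable U.
Proof.
move=> oU.
pose B (qk : 'rV[rat]_p * nat) :=
  ball (map_mx (@ratr R) qk.1) (qk.2.+1%:R^-1 : R).
pose F qk := if pselect (B qk `<=` U) then B qk else set0.
suff -> : U = \bigcup_qk F qk.
  apply: countable_bigcupT_measurable => [|qk]; first exact: countableP.
  rewrite /F; case: pselect => ?; last exact: measurable0.
  by apply: measurable_ball_rV; rewrite invr_gt0.
apply/seteqP; split => [x Ux|x [qk _]]; last first.
  by rewrite /F; case: pselect => // BU /BU.
have /nbhs_ballP[e /= e0 eU] : nbhs x U by exact: open_nbhs_nbhs.
(* Half of [e], because a ball around a nearby rational point reaches up to twice its radius away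
   from [x]. *)
have [k ke] : exists k : nat, k.+1%:R^-1 < e / 2.
  have e20 : 0 < e / 2 by rewrite divr_gt0.
  have [k _ ke] := near_infty_natSinv_lt (PosNum e20).
  by exists k; apply: ke => /=.
have k0 : 0 < k.+1%:R^-1 :> R by rewrite invr_gt0.
have /choice[q qx] : forall i, exists q : rat,
    ratr q \in `]x 0 i - k.+1%:R^-1, x 0 i + k.+1%:R^-1[.
  by move=> i; apply: rat_in_itvoo; rewrite ltrD2l gtrN.
have Bx : B (\row_i q i, k) x.
  split => //= i j; rewrite !mxE (ord1 i) /ball /= ltr_distlC.
  move: (qx j); rewrite in_itv/= => /andP[qx1 qx2].
  by rewrite ltrBlDr qx2 -ltrBlDr.
exists (\row_i q i, k) => //.
rewrite /F; case: pselect => // nBU; exfalso; apply: nBU => y By; apply: eU.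
apply: (@le_ball _ _ _ (k.+1%:R^-1 + k.+1%:R^-1)).
  by rewrite [leRHS]splitr lerD// ltW.
by apply: ball_triangle By; exact: ball_sym.
Qed.

Lemma closed_measurable_rV C : closed C -> measurable C.
Proof. by move/closed_openC/open_measurable_rV/measurableC; rewrite setCK. Qed.

Lemma elipschitz_continuous C L (f : 'rV[R]_p -> R) :
  elipschitz C L f -> {within C, continuous f}.
Proof.
move=> fL; apply/subspace_continuousP => x Cx.
apply/cvgrPdist_lt => e e0.
pose M := `|L| * p%:R + 1.
have M0 : 0 < M by rewrite ltr_wpDl// mulr_ge0.
have eM0 : 0 < e / M by rewrite divr_gt0.
rewrite near_withinE; near=> y => Cy.
have xy : `|x - y| < e / M.
  by near: y; apply: cvgr_dist_lt => //; exact: cvg_id.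
apply: (le_lt_trans (fL _ _ Cx Cy)).
apply: (@le_lt_trans _ _ (M * `|x - y|)); last by rewrite mulrC -ltr_pdivlMr.
apply: (@le_trans _ _ (`|L| * enorm (x - y))).
  by rewrite ler_wpM2r ?enorm_ge0// ler_norm.
apply: (@le_trans _ _ (`|L| * (p%:R * `|x - y|))).
  by rewrite ler_wpM2l// enorm_ler_norm.
by rewrite mulrA ler_wpM2r// lerDl.
Unshelve. all: by end_near. Qed.

(** By continuity within [C], preimages of open intervals are traces on [C] of open sets, and open
    intervals generate the sigma-algebra of the line. *)
Lemma measurable_elipschitz C L (f : 'rV[R]_p -> R) :
  measurable C -> elipschitz C L f ->
  measurable_fun C (f : _ -> measurableTypeR R).
Proof.
move=> mC /elipschitz_continuous/continuousP cf.
apply: (measurability _ (measurable_realfun.RGenOpens.measurableE R)).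
move=> _ [_ [a [b ->] <-]].
have /cf/open_subspaceP[V oV VC] : open `]a, b[%classic by exact: interval_open.
rewrite setIC -VC; apply: measurableI => //; exact: open_measurable_rV.
Qed.

Lemma elipschitz_enorm C x : elipschitz C 1 (fun y => enorm (x - y)).
Proof.
move=> y z _ _; rewrite mul1r [enorm (y - z)]enormC.
by apply: (le_trans (ler_dist_enorm _ _)); rewrite opprB addrC addrA subrK.
Qed.

Lemma measurable_enormB x :
  measurable_fun setT (fun y => enorm (x - y) : measurableTypeR R).
Proof.
by apply: (measurable_elipschitz measurableT); exact: elipschitz_enorm.
Qed.

End topology_rV.

(** * Convexity and Euclidean projection *)

Section convexity.
Context (R : realType) (p : nat).
Implicit Types (x y : 'rV[R]_p) (C : set 'rV[R]_p).

Lemma convex_setP C x y (a : R) : convex_set C -> 0 <= a <= 1 ->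
  C x -> C y -> C (a *: x + (1 - a) *: y).
Proof.
move=> cC /andP[a0 a1] /mem_set Cx /mem_set Cy.
by have /set_mem := cC x y (Itv01 a0 a1) Cx Cy.
Qed.

Lemma convex_functionP C (f : 'rV[R]_p -> R) x y (a : R) :
  convex_function C f -> 0 <= a <= 1 -> C x -> C y ->
  f (a *: x + (1 - a) *: y) <= a * f x + (1 - a) * f y.
Proof.
move=> cf /andP[a0 a1] /mem_set Cx /mem_set Cy.
exact: cf (Itv01 a0 a1) x y Cx Cy.
Qed.

(** [eproj] is a choice with default value 0, so a minimizer must be shown to exist: the distance to
    [x] is continuous and [C] is compact. *)
Lemma eproj_is_argmin C x : C !=set0 -> closed C -> bounded_set C ->
  is_argmin C (fun y => enorm (x - y)) (eproj C x).
Proof.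
move=> C0 cC bC; apply: (@xgetPex _ 0 (is_argmin C (fun y => enorm (x - y)))).
have /(EVT_min_rV C0 (bounded_closed_compact bC cC))[z /set_mem Cz zmin] :=
  elipschitz_continuous (@elipschitz_enorm R p C x).
by exists z; split => // y /mem_set; exact: zmin.
Qed.

(** Variational inequality for the projection: were the inner product positive, a small move from
    the projection towards [y] would come closer to [x]. *)
Lemma dot_eproj_le0 C x y : convex_set C -> closed C -> bounded_set C -> C y ->
  dot (x - eproj C x) (y - eproj C x) <= 0.
Proof.
move=> conC cC bC Cy.
have [CP Pmin] : is_argmin C (fun y => enorm (x - y)) (eproj C x).
  by apply: eproj_is_argmin => //; exists y.
set P := eproj C x in CP Pmin *.
set e := x - P; set d := y - P; rewrite leNgt; apply/negP => ed0.
have D0 := dot_ge0 d; set D := dot d d in D0; set q := dot e d in ed0.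
have qD : 0 < q + D by rewrite ltr_wpDr.
(* This step length lies in []0, 1]] and satisfies [s * D < q]. The squared distance would change by
   [s * (s * D - 2 * q)], which is negative. *)
pose s := q / (q + D).
have s0 : 0 < s by rewrite divr_gt0.
have s1 : s <= 1 by rewrite ler_pdivrMr// mul1r lerDl.
have := Pmin _ (convex_setP conC (_ : 0 <= s <= 1) Cy CP).
rewrite (ltW s0) s1 => /(_ isT).
rewrite -/e (_ : x - _ = e - s *: d); last first.
  by apply/rowP => i; rewrite /e /d !mxE; ring.
clearbody e d.
rewrite -(ler_pXn2r (n := 2))// ?nnegrE ?enorm_ge0// !enorm_sqr.
rewrite !(dotDl, dotDr, dotNl, dotNr, dotZl, dotZr) (dotC d e) -/q -/D.
have sD : s * (q + D) = q by rewrite divfK// gt_eqF.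
move=> h; have : 0 <= s * (s * D - 2 * q) by lra.
rewrite pmulr_rge0// => h2; have : 0 < s * q by rewrite mulr_gt0.
lra.
Qed.

(** With [d] the difference on the left, the variational inequality bounds [enorm d ^+ 2] by
    [- dot b d]; Cauchy-Schwarz and division by [enorm d] conclude. *)
Lemma enorm_eproj_le C y b : convex_set C -> closed C -> bounded_set C -> C y ->
  enorm (y - eproj C (y + b)) <= enorm b.
Proof.
move=> conC cC bC Cy; have := dot_eproj_le0 (y + b) conC cC bC Cy.
set d := y - _; rewrite (_ : y + b - _ = d + b); last by rewrite addrAC.
rewrite dotDl -enorm_sqr => h; have := dot_le_enorm (- b) d.
rewrite dotNl enormN => h2.
have [->|d0] := eqVneq (enorm d) 0; first exact: enorm_ge0.
have dgt0 : 0 < enorm d by rewrite lt_neqAle eq_sym d0 enorm_ge0.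
by rewrite -(ler_pM2r dgt0) -expr2; lra.
Qed.

End convexity.

(** * Intersections of a convex set with a Euclidean ball *)

Section output_set.
Context (R : realType) (p : nat) (C : set 'rV[R]_p) (y : 'rV[R]_p) (r : R).
Implicit Types x : 'rV[R]_p.

(** [out_pert_set] with center and radius as parameters; the two are convertible, so the facts below
    apply to [C0 b] directly. *)
Definition eball_in : set 'rV[R]_p := [set x | C x /\ enorm (x - y) <= r].

Lemma convex_eball_in : convex_set C -> convex_set eball_in.
Proof.
move=> cC a b t /set_mem[Ca ar] /set_mem[Cb br]; apply/mem_set; split.
  by apply/set_mem/cC; exact/mem_set.
rewrite (_ : _ - y = t%:num *: (a - y) + (1 - t%:num) *: (b - y)); last first.
  by apply/rowP => i; rewrite !mxE /unstable.onem; ring.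
have t0 : 0 <= t%:num by [].
have t1 : t%:num <= 1 by [].
apply: (le_trans (enorm_conv _ _ _)); first by rewrite t0 t1.
have := ler_wpM2l t0 ar; have := @ler_wpM2l _ (1 - t%:num) _ _ _ br.
rewrite subr_ge0 => /(_ t1); lra.
Qed.

Lemma measurable_eball_in : measurable C -> measurable eball_in.
Proof.
move=> mC; have := @measurable_enormB R p y.
move=> /(_ measurableT _ (@measurable_itv _ `]-oo, r])); rewrite setTI => mB.
rewrite (_ : eball_in = C `&` [set x | enorm (y - x) \in `]-oo, r]]).
  exact: measurableI.
by apply/seteqP; split => x /=; rewrite /eball_in/= in_itv/= enormC.
Qed.

Lemma ediam_eball_in : eball_in !=set0 -> ediam eball_in <= 2 * r.
Proof.
move=> [x Sx]; apply: ge_sup => [|_ [a [_ ar]] [b [_ br]] <-].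
  by exists (enorm (x - x)); exists x => //; exists x.
apply: (le_trans (ler_enorm_dist _ y _)); rewrite [enorm (y - b)]enormC; lra.
Qed.

Lemma ler_ediam_eball_in a b : eball_in a -> eball_in b ->
  enorm (a - b) <= ediam eball_in.
Proof.
move=> Sa Sb; apply: ub_le_sup; last by exists a => //; exists b.
exists (2 * r) => _ [u [_ ur]] [v [_ vr]] <-.
apply: (le_trans (ler_enorm_dist _ y _)); rewrite [enorm (y - v)]enormC; lra.
Qed.

(** When [x] is too far away, the witness is the point of the segment from [y] to [x] at distance
    [r] from [y]. *)
Lemma eball_in_near x : convex_set C -> C y -> C x -> 0 <= r ->
  exists2 z, eball_in z & enorm (z - x) <= Num.max 0 (enorm (x - y) - r).
Proof.
move=> cC Cy Cx r0.
have [xr|rx] := leP (enorm (x - y)) r.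
  by exists x; [split|rewrite subrr enorm0 le_max lexx].
have d0 : 0 < enorm (x - y) by exact: le_lt_trans rx.
pose s := r / enorm (x - y).
have s0 : 0 <= s by rewrite divr_ge0// enorm_ge0.
have s1 : s <= 1 by rewrite ler_pdivrMr// mul1r ltW.
have sd : s * enorm (x - y) = r by rewrite divfK// gt_eqF.
exists (s *: x + (1 - s) *: y).
  split; first by apply: convex_setP; rewrite ?s0.
  rewrite (_ : _ - y = s *: (x - y)); last first.
    by apply/rowP => i; rewrite !mxE; ring.
  by rewrite enormZ ger0_norm// sd.
rewrite (_ : _ - x = (s - 1) *: (x - y)); last first.
  by apply/rowP => i; rewrite !mxE; ring.
rewrite enormZ ler0_norm ?subr_le0// le_max; apply/orP; right; lra.
Qed.

End output_set.

(** * Mean excess of a sample over a convex set *)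

Section sampling.
Context (R : realType) (p : nat).

(* [u <= ln A + exp u / A] turns a bound A on an exponential moment into the
   bound [ln A + 1] on the mean. *)
Lemma ler_add_expR_div (u s : R) : u <= s + expR u / expR s.
Proof.
have := @expR_ge1Dx R (u - s); rewrite expRD expRN; lra.
Qed.

(** The contraction by 1/2 towards [x0] bounds the moment of [expR (beta / 2 * (f x - f x0))] by
    [2 ^+ p] under [mu], hence by [expR gamma * 2 ^+ p] under [nu]; [ler_add_expR_div] turns this
    into a mean. The gap [f x0 - m] accounts for minimizers outside [S]. *)
Lemma sampling_excess (C S : set 'rV[R]_p) (f : 'rV[R]_p -> R)
    (mu nu : probability 'rV[R]_p R) (x0 : 'rV[R]_p) (beta gamma m : R) :
  measurable C -> measurable S -> S `<=` C ->
  measurable_fun C (f : _ -> measurableTypeR R) ->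
  convex_set S -> convex_function S f -> S x0 -> 0 < beta -> 0 <= gamma ->
  (forall y, C y -> m <= f y) ->
  has_density_propto S (fun x => expR (- (beta * f x))) mu ->
  (forall B, measurable B -> nu B <= (expR gamma)%:E * mu B)%E ->
  (\int[nu]_(x in C) (f x - m)%:E <=
   (2 / beta * (gamma + p%:R + 1) + (f x0 - m))%:E)%E.
Proof.
move=> mC mS SC mfC cS cf Sx0 beta0 gamma0 mf muS numu.
have mfS : measurable_fun S (f : _ -> measurableTypeR R).
  exact: measurable_funS mfC.
have half01 : 0 <= (2^-1 : R) <= 1 by lra.
have mphi : measurable_fun S (fun x => beta * f x : measurableTypeR R).
  exact: measurable_funM.
pose g x := expR (beta / 2 * (f x - f x0)).
have g0 x : 0 <= g x by exact: expR_ge0.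
have mgS : measurable_fun S (g : _ -> measurableTypeR R).
  apply: measurableT_comp => //; apply: measurable_funM => //.
  exact: measurable_funB.
have mug : (\int[mu]_(x in S) (g x)%:E <= (2 ^+ p)%:E)%E.
  have := @expR_moment_propto _ _ S (fun x => beta * f x) mu x0 2^-1 mS mphi.
  rewrite invr_gt0 ltr0n => /(_ isT); rewrite -exprVn invrK => h.
  have {h} := h _ _ muS; rewrite (_ : 1 - 2^-1 = 2^-1); last by field.
  under eq_integral do rewrite -mulrBr mulrA [2^-1 * _]mulrC.
  apply=> [x Sx|x Sx].
    have := convex_setP cS half01 Sx Sx0.
    by rewrite (_ : 1 - 2^-1 = 2^-1)//; field.
  have := convex_functionP cf half01 Sx Sx0.
  rewrite (_ : 1 - 2^-1 = 2^-1 :> R); last by field.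
  rewrite -(ler_pM2l beta0); lra.
have nug : (\int[nu]_(x in S) (g x)%:E <= (expR gamma * 2 ^+ p)%:E)%E.
  pose nmu : {measure set 'rV[R]_p -> \bar R} :=
    mscale (NngNum (expR_ge0 gamma)) mu.
  have mgp : measurable_fun setT ((EFin \o g) \_ S).
    by apply: (proj1 (measurable_restrictT _ mS)); exact/measurable_EFinP.
  have gp0 x : (0 <= ((EFin \o g) \_ S) x)%E.
    by apply: erestrict_ge0 => y _ /=; rewrite lee_fin.
  rewrite integral_mkcond.
  apply: (le_trans
    (@ge0_le_measure_integral _ _ _ nu nmu numu _ setT _ _ _)) => //.
  rewrite ge0_integral_mscale//= -integral_mkcond EFinM.
  by rewrite lee_wpmul2l// lee_fin expR_ge0.
(* [mu] has no mass off [S], so neither has [nu], and the integral over [C] reduces to [S]. *)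
have nuCS : nu (~` S) = 0%E.
  apply/eqP; rewrite eq_le measure_ge0 andbT.
  apply: (le_trans (numu _ (measurableC mS))).
  have [c _ ->] := muS; last exact: measurableC.
  by rewrite setICl integral_set0 mule0.
have mfmC : measurable_fun C (fun x => (f x - m)%:E).
  by apply/measurable_EFinP; exact: measurable_funB.
rewrite (ge0_negligible_integral (measurableC mS) mC mfmC _ nuCS)//; last first.
  by move=> x Cx; rewrite lee_fin subr_ge0 mf.
rewrite setDE setCK setIC (setIidl SC).
(* The logarithm of the moment bound, chosen so that the exponential term of [ler_add_expR_div] has
   mean at most 1. *)
pose s := gamma + p%:R * ln 2.
have As : expR s = expR gamma * 2 ^+ p.
  by rewrite expRD expRM_natl lnK ?posrE.
have s0 : 0 <= s by rewrite addr_ge0// mulr_ge0// ln_ge0// ler1n.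
pose K := 2 / beta * s + (f x0 - m); pose k := 2 / beta / expR s.
have b20 : 0 <= 2 / beta by rewrite divr_ge0// ltW.
have K0 : 0 <= K.
  by apply: addr_ge0; [exact: mulr_ge0|rewrite subr_ge0 mf//; exact: SC].
have k0 : 0 <= k by rewrite divr_ge0// expR_ge0.
apply: (@le_trans _ _ (\int[nu]_(x in S) (K%:E + k%:E * (g x)%:E))%E).
  apply: ge0_le_integral => //.
  - by move=> x /SC/mf; rewrite lee_fin subr_ge0.
  - exact: measurable_funS mfmC.
  - apply: emeasurable_funD => //; apply: emeasurable_funM => //.
    exact/measurable_EFinP.
  - move=> x Sx; rewrite -EFinM -EFinD lee_fin.
    have := ler_wpM2l b20 (ler_add_expR_div (beta / 2 * (f x - f x0)) s).
    rewrite mulrA (_ : 2 / beta * (beta / 2) = 1); last first.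
      by field; exact: lt0r_neq0.
    rewrite -/(g x) /K /k; lra.
rewrite ge0_integralD//; last 2 first.
- by move=> x Sx; rewrite mule_ge0// lee_fin.
- by apply: emeasurable_funM => //; exact/measurable_EFinP.
rewrite integral_cst// ge0_integralZl//; last 2 first.
- exact/measurable_EFinP.
- by move=> x _; rewrite lee_fin.
apply: (@le_trans _ _ (K%:E * 1 + k%:E * (expR s)%:E)%E).
  apply: leeD; first by rewrite lee_wpmul2l ?lee_fin// probability_le1.
  by rewrite lee_wpmul2l ?lee_fin// As.
rewrite mule1 -EFinM -EFinD lee_fin /K /k divfK ?gt_eqF ?expR_gt0//.
have : 2 / beta * s <= 2 / beta * (gamma + p%:R).
  rewrite ler_wpM2l// lerD2l ler_piMr//.
  by have := @le_ln1Dx R 1; rewrite (_ : 1 + 1 = 2)//; apply; lra.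
lra.
Qed.
End sampling.

(** * Monotonicity of the integral *)

Section ge0_le_integral_nonmeasurable.
Local Open Scope ereal_scope.

(** The integral of a nonnegative function is a supremum over the simple functions below it, and
    this set of simple functions grows with the function. It serves to bound the outer integral over
    the noise. *)
Lemma ge0_le_integralT d (T : measurableType d) (R : realType)
    (mu : {measure set T -> \bar R}) (f1 f2 : T -> \bar R) :
  (forall x, 0 <= f1 x) -> (forall x, f1 x <= f2 x) ->
  \int[mu]_x f1 x <= \int[mu]_x f2 x.
Proof.
move=> f10 f12; rewrite !ge0_integralTE//; last first.
  by move=> x; exact: le_trans (f12 x).
apply: ereal_sup_le => _ [h /= hf <-]; exists h => // x.
exact: le_trans (f12 x).
Qed.

End ge0_le_integral_nonmeasurable.

(** * Tail of the noise and nondegeneracy of the sampling set *)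

Section noise.
Context (R : realType) (p : nat).

(** The norm of the noise has mean [p / rho], so the threshold is [t] times the mean. The majorant
    [G] is a multiple of the exponential whose moment is controlled by contracting towards 0 with
    ratio [t^-1]. *)
Lemma noise_excess (noise : probability 'rV[R]_p R) (rho t : R) :
  (0 < p)%N -> 0 < rho -> 3 / 2 <= t ->
  has_density_propto setT (fun b => expR (- rho * enorm b)) noise ->
  exists2 G : 'rV[R]_p -> R,
    measurable_fun setT (G : _ -> measurableTypeR R) /\
    (forall b, Num.max 0 (enorm b - p%:R * t / rho) <= G b) &
    (\int[noise]_b (G b)%:E <= (3 / rho * (t * expR (1 - t)))%:E)%E.
Proof.
move=> p0 rho0 t2 noiseE.
have t0 : 0 < t by lra.
have menorm : measurable_fun setT
    (fun b : 'rV[R]_p => rho * enorm b : measurableTypeR R).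
  apply: measurable_funM => //.
  rewrite (_ : enorm = fun b : 'rV[R]_p => enorm (0 - b)).
    exact: measurable_enormB.
  by apply/funext => b; rewrite sub0r enormN.
pose h (b : 'rV[R]_p) := expR ((1 - t^-1) * (rho * enorm b)).
have mh : measurable_fun setT (h : _ -> measurableTypeR R).
  by apply: measurableT_comp => //; exact: measurable_funM.
have hint : (\int[noise]_b (h b)%:E <= (t ^+ p)%:E)%E.
  have := @expR_moment_propto _ _ setT (fun b => rho * enorm b) noise 0 t^-1
    measurableT menorm.
  rewrite invr_gt0 => /(_ t0); rewrite -exprVn invrK.
  rewrite enorm0 !mulr0.
  under eq_integral do rewrite subr0.
  apply=> // [x _|].
    rewrite scaler0 addr0 addr0 enormZ ger0_norm ?invr_ge0 ?(ltW t0)//.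
    by rewrite mulrCA.
  by under eq_fun do rewrite -mulNr.
(* Normalized so that [k * h b] equals [3 / rho] at the threshold [enorm b = p%:R * t / rho]. *)
pose k := 3 / rho * expR ((1 - t) * p%:R).
have k0 : 0 <= k by rewrite mulr_ge0 ?expR_ge0// divr_ge0// ltW.
exists (fun b => k * h b).
  split; first exact: measurable_funM.
  move=> b; rewrite ge_max mulr_ge0 ?expR_ge0//=.
  rewrite /k /h -[leRHS]mulrA -expRD -ler_pdivrMl ?divr_gt0// invf_div.
  set v := (X in _ <= expR X).
  have ve : v = (1 - t^-1) * (rho * enorm b - p%:R * t).
    by rewrite /v; field; exact: lt0r_neq0.
  have := @expR_ge1Dx R v.
  have -> : rho / 3 * (enorm b - p%:R * t / rho) =
      (rho * enorm b - p%:R * t) / 3.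
    by field; exact: lt0r_neq0.
  have [u0|u0] := leP (rho * enorm b - p%:R * t) 0.
    by move=> _; apply: (le_trans _ (expR_ge0 _)); lra.
  apply: le_trans; rewrite ve.
  (* This is where [3 / 2 <= t] enters; the factor 3 in [k] compensates for the slope 1/3. *)
  have : 3^-1 <= 1 - t^-1.
    have : t^-1 <= (3 / 2)^-1 by rewrite lef_pV2// posrE; lra.
    rewrite invf_div; lra.
  move=> /(ler_wpM2r (ltW u0)); lra.
under eq_integral do rewrite EFinM.
rewrite ge0_integralZl//; last 2 first.
- exact/measurable_EFinP.
- by move=> b _; rewrite lee_fin expR_ge0.
apply: (@le_trans _ _ (k%:E * (t ^+ p)%:E)%E).
  by rewrite lee_wpmul2l.
rewrite -EFinM lee_fin /k -[leLHS]mulrA ler_wpM2l ?divr_ge0 ?(ltW rho0)//.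
rewrite mulrC expRM_natr -exprMn.
have te1 : t * expR (1 - t) <= 1.
  have -> : 1 - t = - (t - 1) by lra.
  rewrite expRN ler_pdivrMr ?expR_gt0// mul1r.
  by have := @expR_ge1Dx R (t - 1); lra.
have te0 : 0 <= t * expR (1 - t) by rewrite mulr_ge0 ?expR_ge0// ltW.
by case: p p0 => // q _; rewrite exprS ler_piMr// exprn_ile1.
Qed.

Lemma lebesgue_rV_set1 (y : 'rV[R]_p) :
  (0 < p)%N -> lebesgue_rV p [set y] = 0%E.
Proof.
move=> p0; rewrite (_ : [set y] = [set x | forall i, y 0 i <= x 0 i <= y 0 i]).
  rewrite lebesgue_rV_box//; congr EFin.
  by rewrite (bigD1 (Ordinal p0))//= subrr mul0r.
apply/seteqP; split => [x -> i|x xy]; first by rewrite lexx.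
by apply/rowP => i; apply/eqP; rewrite eq_le andbC xy.
Qed.

(** A set of diameter 0 is a single point, which is Lebesgue-null in positive dimension and so
    cannot carry a probability with a density. This legitimates the division by [ediam]. *)
Lemma ediam_propto_gt0 (C : set 'rV[R]_p) y r w mu :
  (0 < p)%N -> eball_in C y r y -> measurable (eball_in C y r) ->
  has_density_propto (eball_in C y r) w mu -> 0 < ediam (eball_in C y r).
Proof.
move=> p0; set S := eball_in C y r => Sy mS [c c0 muE].
have d0 : 0 <= ediam S.
  by apply: le_trans (ler_ediam_eball_in Sy Sy); exact: enorm_ge0.
rewrite lt_neqAle eq_sym d0 andbT; apply/negP => /eqP S0.
have Sy1 : S = [set y].
  apply/seteqP; split => [x Sx|_ -> //].
  apply/eqP; rewrite -subr_eq0; apply/eqP/enorm0_eq0/eqP.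
  by rewrite eq_le enorm_ge0 -S0 ler_ediam_eball_in.
have := muE setT measurableT; rewrite setTI (eq_integral (cst (c * w y)%:E)).
  rewrite integral_cst// Sy1 (_ : (_ * _)%E = 0%E); last first.
    by rewrite -(mule0 (c * w y)%:E) -(lebesgue_rV_set1 y p0).
  by rewrite probability_setT => /eqP; rewrite onee_eq0.
by move=> x; rewrite Sy1 inE => ->.
Qed.

End noise.

(** * The empirical risk and the combination of the two stages *)

Section risk.
Context (R : realType) (p : nat) (C : set 'rV[R]_p) (U : Type).
Context (ell : U -> 'rV[R]_p -> R) (n : nat) (D : n.-tuple U).

Lemma elipschitz_risk L : (forall d, elipschitz C L (ell d)) ->
  elipschitz C (n%:R * L) (empirical_risk ell D).
Proof.
move=> lL x y Cx Cy; rewrite /empirical_risk -sumrB.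
apply: (le_trans (ler_norm_sum _ _ _)).
rewrite -mulrA mulr_natl -[n in leRHS]card_ord -sumr_const.
by apply: ler_sum => i _; exact: lL.
Qed.

Lemma convex_risk : (forall d, convex_function C (ell d)) ->
  convex_function C (empirical_risk ell D).
Proof.
move=> cl t x y Cx Cy; rewrite /empirical_risk convRE !mulr_sumr -big_split.
by apply: ler_sum => i _; exact: cl.
Qed.

End risk.

(** The bound on [ln (g theta)] makes the density [g] at most [expR (e / 3)] on [S]. *)
Lemma efficient_exp_sampling_le (R : realType) (p : nat) (L e : R)
    (f : 'rV[R]_p -> R) S nu :
  measurable S -> efficient_exp_sampling L e f S nu ->
  exists2 mu : probability 'rV[R]_p R,
    has_density_propto S
      (fun x => expR (- (e / (6 * L * ediam S)) * f x)) mu &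
    forall B, measurable B -> (nu B <= (expR (e / 3))%:E * mu B)%E.
Proof.
move=> mS [mu [g [muS mg gE nuE]]]; exists mu => // B mB.
have mBS : measurable (B `&` S) by exact: measurableI.
rewrite nuE//.
apply: (@le_trans _ _ (\int[mu]_(x in B `&` S) (expR (e / 3))%:E)%E).
  apply: ge0_le_integral => //.
  - by move=> x [_ /gE[g0 _]]; rewrite lee_fin ltW.
  - by apply/measurable_EFinP; exact: measurable_funS mg.
  - move=> x [_ /gE[g0 /(le_trans (ler_norm _)) lng]].
    by rewrite lee_fin -[leLHS]lnK ?posrE// ler_expR.
rewrite integral_cst// lee_wpmul2l ?lee_fin ?expR_ge0//.
by apply: le_measure; rewrite ?inE.
Qed.

(** Covers both samplers: [k = 2] and [gamma = 0] for the exact one, [k = 6] and [gamma = e / 3] for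
    the efficient one. The comparison point is that of [eball_in_near], at a cost bounded by the
    Lipschitz constant [n%:R * L]. *)
Lemma sampling_stage (R : realType) (p n : nat) (C : set 'rV[R]_p)
    (f : 'rV[R]_p -> R) (L e k gamma r : R) (y x : 'rV[R]_p)
    (mu nu : probability 'rV[R]_p R) :
  let S := eball_in C y r in
  (0 < p)%N -> 0 < L -> 0 < e -> 0 < k -> 0 <= gamma -> 0 <= r ->
  closed C -> convex_set C ->
  convex_function C f -> elipschitz C (n%:R * L) f -> C y -> is_argmin C f x ->
  has_density_propto S (fun z => expR (- (e / (k * L * ediam S)) * f z)) mu ->
  (forall B, measurable B -> nu B <= (expR gamma)%:E * mu B)%E ->
  (\int[nu]_(z in C) (f z - f x)%:E <=
    (4 * k * L * r / e * (gamma + p%:R + 1) +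
     n%:R * L * Num.max 0 (enorm (x - y) - r))%:E)%E.
Proof.
move=> S p0 L0 e0 k0 gamma0 r0 cC conC cf fL Cy [Cx xmin] muS numu.
have mC := closed_measurable_rV cC.
have mS : measurable S by exact: measurable_eball_in.
have Sy : S y by split; rewrite ?subrr ?enorm0.
have d0 : 0 < ediam S by exact: ediam_propto_gt0 muS.
have d2r : ediam S <= 2 * r by apply: ediam_eball_in; exists y.
have [z Sz zx] := eball_in_near conC Cy Cx r0.
have SC : S `<=` C by move=> ? [].
have cfS : convex_function S f.
  by move=> t a b /set_mem/SC/mem_set Ca /set_mem/SC/mem_set Cb; exact: cf.
set beta := e / (k * L * ediam S) in muS.
have beta0 : 0 < beta by rewrite divr_gt0// !mulr_gt0.
have muS' : has_density_propto S (fun z => expR (- (beta * f z))) mu.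
  by move: muS; under eq_fun do rewrite mulNr.
have mfC := measurable_elipschitz mC fL.
apply: (le_trans (sampling_excess mC mS SC mfC (convex_eball_in conC) cfS Sz
  beta0 gamma0 xmin muS' numu)).
rewrite lee_fin lerD//.
  rewrite ler_wpM2r ?addr_ge0//.
  have -> : 2 / beta = 2 * k * L / e * ediam S.
    by rewrite /beta; field; rewrite !gt_eqF.
  have -> : 4 * k * L * r / e = 2 * k * L / e * (2 * r).
    by field; rewrite gt_eqF.
  by rewrite ler_wpM2l// divr_ge0 ?mulr_ge0// ltW.
apply: (le_trans (ler_norm _)).
apply: (le_trans (fL _ _ (SC _ Sz) Cx)).
by rewrite ler_wpM2l// mulr_ge0// ltW.
Qed.

Theorem theorem4p3 (R : realType) (c : R) (c_gt0 : 0 < c) :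
  exists2 K : R, 0 < K &
  forall (p n : nat) (C : set 'rV[R]_p) (U : Type) (ell : U -> 'rV[R]_p -> R)
    (L Delta eps : R) (D : n.-tuple U) (thstar : 'rV[R]_p)
    (noise : probability 'rV[R]_p R)
    (Agen : set 'rV[R]_p -> probability 'rV[R]_p R),
    let risk := empirical_risk ell D in
    let C0 := out_pert_set C n L Delta (eps / 2) (3 * ln n%:R) thstar in
    (0 < p)%N -> (0 < n)%N -> 0 < L -> 0 < Delta -> 0 < eps ->
    closed C -> bounded_set C -> convex_set C ->
    (forall d, convex_function C (ell d)) ->
    (forall d, elipschitz C L (ell d)) ->
    (forall d, strongly_convex C Delta (ell d)) ->
    is_argmin C risk thstar ->
    out_pert_noise n L Delta (eps / 2) noise ->
    (forall B, measurable B ->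
       measurable_fun setT (fun b => Agen (C0 b) B)) ->
    (eps <= c * (p * n)%:R ^+ 2 /\
       (forall b, exp_sampling L (eps / 2) risk (C0 b) (Agen (C0 b)))) \/
    (eps <= c * p%:R /\
       (forall b, efficient_exp_sampling L (eps / 2) risk (C0 b) (Agen (C0 b)))) ->
    (two_stage_expectation noise C0 Agen C
       (fun theta => risk theta - risk thstar)%R
     <= (K * (p%:R ^+ 2 * L ^+ 2 / (n%:R * Delta * eps ^+ 2) * ln n%:R))%:E)%E.
Proof.
(* The first summand pays for sampling, with [576 = 96 * 6] from [k <= 6] and [c + 2] from
   [gamma + p%:R + 1 <= (c + 2) * p%:R]; the second pays for the minimizer lying outside [C0]. *)
exists (576 * (c + 2) + 36 * expR 1 * c).
  apply: addr_gt0; first by apply: mulr_gt0; lra.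
  by apply: mulr_gt0 => //; rewrite pmulr_rgt0 ?expR_gt0//; lra.
move=> p n C U ell L Delta eps D thstar noise Agen risk C0 p0 n0 L0 Delta0 eps0.
move=> cC bC conC cell lell _ thmin noiseE _ AE.
have [Cth rmin] := thmin.
have np : 0 < n%:R :> R by rewrite ltr0n.
have pp : 1 <= p%:R :> R by rewrite ler1n.
have n1 : 1 <= n%:R :> R by rewrite ler1n.
have fL := elipschitz_risk D lell; have cf := convex_risk D cell.
pose th0 b := eproj C (thstar + b).
pose r := 3 * ln n%:R * (2 * L * p%:R / (Delta * (eps / 2) * n%:R)).
have Cth0 b : C (th0 b).
  by have [] : is_argmin C (fun y => enorm (thstar + b - y)) (th0 b)
    by apply: eproj_is_argmin => //; exists thstar.
have mC := closed_measurable_rV cC.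
have ln0 : 0 <= ln n%:R :> R by exact: ln_ge0.
have r0 : 0 <= r.
  by rewrite !mulr_ge0// ?invr_ge0 ?mulr_ge0// ltW.
(* Both alternatives are brought to one form; the range [eps <= c * p%:R] lies in the other one
   because [p] and [n] are at least 1. *)
have [epsc [k [k0 k6 [gamma [gamma0 gammac Ak]]]]] :
    eps <= c * (p%:R * n%:R) ^+ 2 /\
    exists k : R, [/\ 0 < k, k <= 6 & exists gamma : R,
    [/\ 0 <= gamma, gamma <= c * p%:R &
      forall b, exists2 mu : probability 'rV[R]_p R,
      has_density_propto (C0 b)
        (fun x => expR (- (eps / 2 / (k * L * ediam (C0 b))) * risk x)) mu &
      forall B, measurable B -> (Agen (C0 b) B <= (expR gamma)%:E * mu B)%E]].
  case: AE => -[epsc Ab].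
    split; first by rewrite -natrM.
    exists 2; split; [lra|lra|]; exists 0; split => //.
      by rewrite mulr_ge0// ltW.
    move=> b; exists (Agen (C0 b)); first exact: Ab.
    by move=> B mB; rewrite expR0 mul1e.
  split.
    apply: (le_trans epsc); rewrite ler_pM2l// expr2.
    by rewrite -[leLHS]mulr1 -mulrA ler_wpM2l// !mulr_ege1.
  exists 6; split; [lra|lra|]; exists (eps / 2 / 3); split => //; [lra|lra|].
  move=> b; apply: efficient_exp_sampling_le; last exact: Ab.
  exact: measurable_eball_in.
pose rho := n%:R * Delta * (eps / 2) / (2 * L).
have rho0 : 0 < rho by rewrite divr_gt0// !mulr_gt0// divr_gt0.
(* For [n = 1] the radius of [C0] vanishes and no density exists on [C0]. *)
have n2 : (2 <= n)%N.
  have [mu muS _] := Ak 0.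
  have Sth : eball_in C (th0 0) r (th0 0) by split; rewrite ?subrr ?enorm0.
  have := ediam_propto_gt0 p0 Sth (measurable_eball_in _ _ mC) muS.
  apply: contraTT; rewrite -ltnNge -leNgt => n1'.
  have /eqP n1E : (n == 1)%N by rewrite eqn_leq n0 -ltnS n1'.
  have r_0 : r = 0 by rewrite /r n1E ln1 mulr0 mul0r.
  rewrite (le_trans (ediam_eball_in _))// ?r_0 ?mulr0//.
  by exists (th0 0); rewrite -r_0.
pose t := 3 * ln n%:R : R.
(* From [2 <= n] and [1 / 2 <= ln 2], the latter being [ln (1 + x) <= x] at [x = - (1 / 2)]. *)
have t2 : 3 / 2 <= t.
  have ln2 : 1 / 2 <= ln 2 :> R.
    have := @le_ln1Dx R (- (1 / 2)).
    rewrite (_ : 1 + - (1 / 2) = 2^-1); last by field.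
    by rewrite lnV ?posrE//; lra.
  have : ln 2 <= ln n%:R :> R by rewrite ler_ln ?posrE// ler_nat.
  rewrite /t; lra.
have rE : r = p%:R * t / rho.
  by rewrite /r /rho /t; field; rewrite !gt_eqF.
have noiseE' : has_density_propto setT (fun b => expR (- rho * enorm b)) noise.
  exact: noiseE.
have [G [mG Gge] Gint] := noise_excess p0 rho0 t2 noiseE'.
have G0 b : 0 <= G b by apply: le_trans (Gge b); rewrite le_max lexx.
pose K1 := 4 * k * L * r / (eps / 2) * (gamma + p%:R + 1).
have K10 : 0 <= K1.
  apply: mulr_ge0; last lra.
  apply: divr_ge0; last lra.
  by do 2 apply: mulr_ge0 => //; [apply: mulr_ge0 => //|]; exact: ltW.
rewrite /two_stage_expectation.
(* [K1] is the same for every [b]; the noise enters only through the distance from [thstar] to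
   [th0 b], at most [enorm b], and hence through [G]. *)
apply: (@le_trans _ _ (\int[noise]_b (K1%:E + (n%:R * L)%:E * (G b)%:E))%E).
  apply: ge0_le_integralT => b.
    by apply: integral_ge0 => x Cx; rewrite lee_fin subr_ge0 rmin.
  have [mu muS numu] := Ak b.
  apply: (le_trans (sampling_stage p0 L0 (divr_gt0 eps0 (ltr0n _ 2)) k0 gamma0
    r0 cC conC cf fL (Cth0 b) thmin muS numu)).
  rewrite -EFinM -EFinD lee_fin lerD2l ler_wpM2l ?mulr_ge0// ?(ltW L0)//.
  apply: le_trans (Gge b); rewrite -rE ge_max le_max lexx /=.
  rewrite le_max lerD2r enorm_eproj_le ?orbT//.
rewrite ge0_integralD//; last 2 first.
- by move=> b _; rewrite mule_ge0// lee_fin// mulr_ge0// ltW.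
- by apply: emeasurable_funM => //; exact/measurable_EFinP.
rewrite integral_cst// ge0_integralZl//; last 3 first.
- exact/measurable_EFinP.
- by move=> b _; rewrite lee_fin.
- by rewrite lee_fin mulr_ge0// ltW.
rewrite [X in (K1%:E * X + _)%E](_ : _ = 1%E) ?mule1; last first.
  exact: (probability_setT noise).
apply: (@le_trans _ _
  (K1%:E + (n%:R * L)%:E * (3 / rho * (t * expR (1 - t)))%:E)%E).
  by rewrite leeD2l// lee_wpmul2l// lee_fin mulr_ge0// ltW.
rewrite -EFinM -EFinD lee_fin.
rewrite [leRHS]mulrDl lerD//.
  have -> : K1 = 96 * k * (gamma + p%:R + 1) *
      (p%:R * L ^+ 2 / (n%:R * Delta * eps ^+ 2) * ln n%:R).
    by rewrite /K1 /r; field; rewrite !gt_eqF.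
  have -> : 576 * (c + 2) * (p%:R ^+ 2 * L ^+ 2 / (n%:R * Delta * eps ^+ 2) *
      ln n%:R) = 96 * 6 * ((c + 2) * p%:R) *
      (p%:R * L ^+ 2 / (n%:R * Delta * eps ^+ 2) * ln n%:R).
    by field; rewrite !gt_eqF.
  rewrite ler_wpM2r//.
    by rewrite mulr_ge0// divr_ge0 ?mulr_ge0 ?sqr_ge0// ltW.
  by apply: ler_pM; [lra|lra|lra|lra].
(* The factor 3 in [t] yields the cube of [n]. The remaining term has a spare factor [eps], which
   [eps <= c * (p%:R * n%:R) ^+ 2] absorbs. *)
have expt : expR (1 - t) = expR 1 / n%:R ^+ 3.
  by rewrite expRD expRN /t expRM_natl lnK ?posrE.
have -> : n%:R * L * (3 / rho * (t * expR (1 - t))) =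
    36 * expR 1 * (L ^+ 2 / (n%:R ^+ 3 * Delta * eps ^+ 2) * ln n%:R) * eps.
  by rewrite expt /rho /t; field; rewrite !gt_eqF.
have -> : 36 * expR 1 * c * (p%:R ^+ 2 * L ^+ 2 / (n%:R * Delta * eps ^+ 2) *
    ln n%:R) = 36 * expR 1 * (L ^+ 2 / (n%:R ^+ 3 * Delta * eps ^+ 2) *
    ln n%:R) * (c * (p%:R * n%:R) ^+ 2).
  by field; rewrite !gt_eqF.
rewrite ler_wpM2l// !mulr_ge0 ?expR_ge0// ?invr_ge0 ?mulr_ge0 ?exprn_ge0//;
  exact: ltW.
Qed.
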